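(* Let $q$ be a nonzero complex number with $|q|<1$, and let $a,b$ be complex numbers with $b\neq 0$ and $\left|\frac{q}{b}\right|<1$. Assume that no zero denominators occur below, i.e. $a+b\neq 0$ and none of $\frac{aq}{b},\ \frac{(q+b)aq}{a+b},\ \frac{(1+b)a}{a+b}$ is of the form $q^{-k}$ with $k\ge 0$ an integer. Then $${}_4\phi_3\!\left[\begin{matrix}a,\; b,\; \frac{(q+b)a}{(a+b)q},\; \frac{(1+b)aq}{a+b}\\[2pt] \frac{aq}{b},\; \frac{(q+b)aq}{a+b},\; \frac{(1+b)a}{a+b}\end{matrix};q,-\frac{q}{b}\right] =\frac{a+b-aq-ab}{b}\;\frac{(-q;q)_\infty}{(-q/b;q)_\infty\,(aq/b;q)_\infty}\,(aq^2;q^2)_\infty\,(aq^3/b^2;q^2)_\infty .$$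
   Context: For a complex number $p$ with $|p|<1$ and complex $x$: $(x;p)_0=1$, $(x;p)_n=\prod_{k=0}^{n-1}(1-xp^k)$ for $n\ge1$, and $(x;p)_\infty=\prod_{k=0}^{\infty}(1-xp^k)$ (used with $p=q$ and $p=q^2$). The basic hypergeometric series is $${}_4\phi_3\!\left[\begin{matrix}a_1,a_2,a_3,a_4\\ b_1,b_2,b_3\end{matrix};q,x\right]=\sum_{n=0}^{\infty}\frac{(a_1;q)_n(a_2;q)_n(a_3;q)_n(a_4;q)_n}{(q;q)_n(b_1;q)_n(b_2;q)_n(b_3;q)_n}x^n .$$ *)

(* Defs.v *)
From Stdlib Require Import Reals.
From Coquelicot Require Import Coquelicot.
Local Open Scope C_scope.

Fixpoint qpoch (x p : C) (n : nat) : C :=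
  match n with
  | O => 1
  | S k => qpoch x p k * (1 - x * p ^ k)
  end.

(* [lim] is total; the partial products converge whenever |p| < 1. *)
Definition qpoch_inf (x p : C) : C :=
  @lim C_CompleteNormedModule (filtermap (qpoch x p) eventually).

Lemma qpoch_inf_unique (x p l : C) :
  filterlim (qpoch x p) eventually (@locally C_UniformSpace l) ->
  qpoch_inf x p = l.
Proof.
intros H.
assert (PF : ProperFilter (filtermap (qpoch x p) eventually))
  by apply filtermap_proper_filter, eventually_filter.
apply eq_sym, (filterlim_locally_unique (K:=C_AbsRing) (V:=C_NormedModule) (F:=eventually) (qpoch x p)).
- exact H.
- apply filterlim_locally. intros eps.
  refine (complete_cauchy (T:=C_CompleteNormedModule) (filtermap (qpoch x p) eventually) PF _ eps).
  intros e; exists l; exact (proj1 (filterlim_locally _ _) H e).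
Qed.

Definition phi43_term (a1 a2 a3 a4 b1 b2 b3 q x : C) (n : nat) : C :=
  (qpoch a1 q n * qpoch a2 q n * qpoch a3 q n * qpoch a4 q n)
  / (qpoch q q n * qpoch b1 q n * qpoch b2 q n * qpoch b3 q n) * x ^ n.

(* Summability is part of the relation: the partial sums converge in C to s. *)
Definition is_phi43 (a1 a2 a3 a4 b1 b2 b3 q x s : C) : Prop :=
  @is_series C_AbsRing C_NormedModule
    (phi43_term a1 a2 a3 a4 b1 b2 b3 q x) s.

(* Main.v *)
Require Import Defs.
From Stdlib Require Import Reals Lra Lia.
From Coquelicot Require Import Coquelicot.
Local Open Scope C_scope.
Set Bullet Behavior "Strict Subproofs".

(** Put [z = -q/b], [c = (q+b)a/(a+b)] and [d = (1+b)a/(a+b)].  In the series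
    the pairs [(c/q;q)_n / (cq;q)_n] and [(dq;q)_n / (d;q)_n] collapse to
    rational functions of [q^n], so its terms are a rational multiple of those
    of the well-poised series
      [f(a) = sum_n (a;q)_n (b;q)_n / ((q;q)_n (aq/b;q)_n) z^n].
    The right-hand side is, up to an elementary factor, the product that the
    Bailey-Daum theorem attaches to [f(aq)].  This suggests comparing the two
    series term by term, and indeed their difference telescopes
    ([phi43_telescope]):
      [t_n - (a+b-aq-ab)/(b-aq) * (n-th term of f(aq)) = H_n - H_(n-1)],
    where [H_n] is a bounded sequence times [z^(n+1)] and so tends to 0.

    It remains to sum [f].  The usual proof of Bailey-Daum passes through
    Heine's transformation and analytic continuation in [a]; here the same
    telescoping idea gives it directly.  A second certificate
    ([bd_telescope]) shows
      [(1-aq/b)(1-aq^2/b) f(a) = (1-aq)(1-aq^2/b^2) f(aq^2)],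
    and iterating leads to [f(a q^(2N))], which converges to [f(0)] because
    the coefficients depend on [a] in a uniformly Lipschitz way near 0
    ([bd_near_0]).  Finally [f(0) = sum_n (b;q)_n/(q;q)_n z^n] is given by the
    q-binomial theorem, proved once more by telescoping: a relation between
    the sums at [z] and [zq], iterated until the argument reaches 0
    ([qbinomial]).

    The analysis rests on two facts.  For [|x| <= (1-|p|)/4] every [(x;p)_n]
    is within [2|x|/(1-|p|)] of 1 ([qpoch_near_1]); splitting off finitely many
    factors then bounds [(x;p)_n] for every [x], and also its inverse when no
    factor vanishes.  And a series dominated by [M r^n] converges to a sum of
    modulus at most [M/(1-r)]. *)

(** * The shifted factorial: algebra *)

Definition qregular (x p : C) : Prop := forall k : nat, 1 - x * p ^ k <> 0.

Lemma qpoch_S (x p : C) (n : nat) :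
  qpoch x p (S n) = qpoch x p n * (1 - x * p ^ n).
Proof. reflexivity. Qed.

Lemma qpoch_shift (x p : C) (n : nat) :
  qpoch x p (S n) = (1 - x) * qpoch (x * p) p n.
Proof.
induction n as [|n IH].
- simpl. ring.
- rewrite qpoch_S, IH, qpoch_S, Cpow_S. ring.
Qed.

Lemma qpoch_split (x p : C) (m n : nat) :
  qpoch x p (m + n) = qpoch x p m * qpoch (x * p ^ m) p n.
Proof.
induction n as [|n IH].
- rewrite Nat.add_0_r. simpl. ring.
- rewrite Nat.add_succ_r, !qpoch_S, IH, Cpow_add_r. ring.
Qed.

Lemma qregular_neq_0 (x p : C) (n : nat) : qregular x p -> qpoch x p n <> 0.
Proof.
intros H. induction n as [|n IH]; simpl.
- exact C1_nz.
- apply Cmult_neq_0; [exact IH | apply H].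
Qed.

Lemma qregular_shift (x p : C) (m : nat) : qregular x p -> qregular (x * p ^ m) p.
Proof.
intros H k. replace (x * p ^ m * p ^ k) with (x * p ^ (m + k)).
- apply H.
- rewrite Cpow_add_r. ring.
Qed.

Lemma qregular_S (x p : C) : qregular x p -> qregular (x * p) p.
Proof. intros H. rewrite <- (Cpow_1_r p) at 1. now apply qregular_shift. Qed.

(** Partial sums including the term of index [n]; the group structure is fixed
    so that [Csum_S] speaks of addition in [C] itself. *)
Definition Csum (u : nat -> C) (n : nat) : C := @sum_n C_AbelianGroup u n.

Lemma Csum_0 (u : nat -> C) : Csum u 0 = u 0%nat.
Proof. exact (sum_O u). Qed.

Lemma Csum_S (u : nat -> C) (n : nat) : Csum u (S n) = Csum u n + u (S n).
Proof. exact (sum_Sn u n). Qed.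

Lemma Csum_telescope (u H : nat -> C) :
  u 0%nat = H 0%nat -> (forall n, u (S n) = H (S n) - H n) ->
  forall n, Csum u n = H n.
Proof.
intros H0 HS n. induction n as [|n IH].
- now rewrite Csum_0.
- rewrite Csum_S, IH, HS. ring.
Qed.

(** * Telescoping certificates *)

(** The term of the well-poised series summed by the Bailey-Daum theorem. *)
Definition bd_term (a b q : C) (n : nat) : C :=
  qpoch a q n * qpoch b q n / (qpoch q q n * qpoch (a * q / b) q n)
  * (- (q / b)) ^ n.

Definition binom_term (b q z : C) (n : nat) : C :=
  qpoch b q n / qpoch q q n * z ^ n.

(** With [c_k = (b;q)_k / (q;q)_k] the summand is
    [c_k (1-q^k) z^k - c_(k+1) (1-q^(k+1)) z^(k+1)], because
    [c_(k+1) (1-q^(k+1)) = c_k (1 - b q^k)]. *)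
Lemma binom_telescope (b q z : C) (n : nat) :
  qregular q q ->
  Csum (fun k => (1 - z) * binom_term b q z k - (1 - b * z) * binom_term b q (z * q) k) n
  = - (qpoch b q (S n) / qpoch q q n * z ^ S n).
Proof.
intros Hq. revert n. apply Csum_telescope; unfold binom_term.
- simpl. field.
- intros n. rewrite !(qpoch_S b), !(qpoch_S q q), !Cpow_S, Cpow_mult_l.
  pose proof (qregular_neq_0 q q n Hq) as D1. pose proof (Hq n) as D2.
  set (X := q ^ n) in *. field. split; assumption.
Qed.

(** Both shifts of [a] are expressed through [(aq;q)_n] and [(aq/b;q)_n], the
    factorials in which the certificates below are written.  The factor
    [1 - aq] in the second one is kept outside so that [aq = 1] is covered. *)
Lemma bd_term_shift (a b q : C) (n : nat) :
  b <> 0 -> qregular q q -> qregular (a * q / b) q ->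
  bd_term (a * q) b q n
  = qpoch (a * q) q n * qpoch b q n * (1 - a * q / b)
    / (qpoch q q n * qpoch (a * q / b) q (S n)) * (- (q / b)) ^ n.
Proof.
intros Hb Hq Hd. unfold bd_term.
replace (a * q * q / b) with (a * q / b * q) by (field; assumption).
pose proof (qregular_neq_0 _ _ n Hq). pose proof (qregular_neq_0 _ _ (S n) Hd).
pose proof (qregular_neq_0 _ _ n (qregular_S _ _ Hd)).
rewrite (qpoch_shift (a * q / b)) in H0 |- *.
assert (1 - a * q / b <> 0) by (intros Z; apply H0; rewrite Z; ring).
set (d := a * q / b) in *. field. repeat split; assumption.
Qed.

Lemma bd_term_shift2 (a b q : C) (n : nat) :
  b <> 0 -> qregular q q -> qregular (a * q / b) q ->
  (1 - a * q) * bd_term (a * q ^ 2) b q n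
  = qpoch (a * q) q (S n) * qpoch b q n * ((1 - a * q / b) * (1 - a * q ^ 2 / b))
    / (qpoch q q n * qpoch (a * q / b) q (S (S n))) * (- (q / b)) ^ n.
Proof.
intros Hb Hq Hd.
replace (a * q ^ 2) with (a * q * q) by ring.
assert (E : a * q * q / b = a * q / b * q) by (field; assumption).
rewrite bd_term_shift by (try rewrite E; try apply qregular_S; assumption).
rewrite E, (qpoch_shift (a * q)), (qpoch_shift _ _ (S n)).
pose proof (Hd 0%nat) as H0. simpl in H0. rewrite Cmult_1_r in H0.
pose proof (qregular_neq_0 _ _ n Hq).
pose proof (qregular_neq_0 _ _ (S n) (qregular_S _ _ Hd)) as H2.
set (D := qpoch (a * q / b * q) q (S n)) in *.
assert (1 - a * q / b = (b - a * q) / b) by (field; assumption).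
assert (b - a * q <> 0). { intros Z. apply H0. rewrite H1, Z. field. assumption. }
field. repeat split; assumption.
Qed.

(** The form in which [field] asks for the factors of [(aq/b;q)_n]. *)
Lemma regular_cleared (a b q : C) (n : nat) :
  b <> 0 -> 1 - a * q / b * q ^ n <> 0 -> b - a * q * q ^ n <> 0.
Proof.
intros Hb H Z. apply H. replace (1 - a * q / b * q ^ n) with ((b - a * q * q ^ n) / b) by (field; assumption).
rewrite Z. field. assumption.
Qed.

(** With [x = q^k] and [u_k] the term of [f(a)], the summand is the increment of
    [y (1-x) u_k / (1 - aqx/b)] for a constant [y]; dividing by [u_k] leaves
    an identity between polynomials of degree 2 in [x], and [x = 0] gives
    [y = a (1-q/b) (1-aq/b) (1-aq^2/b) / (1-a)].  The factor [1-x] vanishes at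
    [k = 0], so nothing is left over there, and the [1-a] in the denominator
    is absorbed by turning [(a;q)_(n+1)] into [(aq;q)_n]. *)
Lemma bd_telescope (a b q : C) (n : nat) :
  b <> 0 -> qregular q q -> qregular (a * q / b) q ->
  Csum (fun k => (1 - a * q / b) * (1 - a * q ^ 2 / b) * bd_term a b q k
     - (1 - a * q ^ 2 / b ^ 2) * ((1 - a * q) * bd_term (a * q ^ 2) b q k)) n
  = (1 - a * q / b) * (1 - a * q ^ 2 / b) *
    (a * (1 - q / b) * (qpoch (a * q) q n * qpoch b q (S n)
      / (qpoch q q n * qpoch (a * q / b) q (S (S n)))) * (- (q / b)) ^ S n).
Proof.
intros Hb Hq Hd.
revert n. apply Csum_telescope.
- rewrite bd_term_shift2 by assumption. unfold bd_term. simpl.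
  pose proof (regular_cleared a b q 0 Hb (Hd 0%nat)) as H0.
  pose proof (regular_cleared a b q 1 Hb (Hd 1%nat)) as H1. simpl in H0, H1.
  rewrite Cmult_1_r in H0, H1.
  field. repeat split; assumption.
- intros n. rewrite bd_term_shift2 by assumption. unfold bd_term.
  rewrite (qpoch_shift a), (qpoch_S _ _ (S (S n))), (qpoch_S (a * q / b) q (S n)),
   (qpoch_S (a * q / b) q n), (qpoch_S (a * q) q (S n)), (qpoch_S (a * q) q n),
   (qpoch_S b q (S n)), (qpoch_S q q n), !Cpow_S.
  pose proof (regular_cleared a b q n Hb (Hd n)) as H0.
  pose proof (regular_cleared a b q (S n) Hb (Hd (S n))) as H1.
  pose proof (regular_cleared a b q (S (S n)) Hb (Hd (S (S n)))) as H2.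
  pose proof (qregular_neq_0 _ _ n Hq). pose proof (qregular_neq_0 _ _ n Hd).
  pose proof (Hq n) as H5.
  rewrite !Cpow_S in *.
  set (X := q ^ n) in *. set (D := qpoch (a * q / b) q n) in *.
  field. repeat split; assumption.
Qed.

(** Again the certificate is a constant times [(1-x) u_k / (1 - cx/q)], where
    [x = q^k] and [u_k] is the term of [f(a)], the constant having [1-c] as a
    factor.  Writing [(1-c) / (1 - c q^n)] as [(c;q)_n / (cq;q)_n] avoids 0/0
    at [n = 0] when [c = 1], the case where the right-hand side of the theorem
    vanishes.  Regularity of [d] forces [a <> 1], as [1-d = b(1-a)/(a+b)]. *)
Lemma phi43_telescope (a b q : C) (n : nat) :
  let c := (q + b) * a / (a + b) in
  let d := (1 + b) * a / (a + b) in
  q <> 0 -> b <> 0 -> a + b <> 0 ->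
  qregular q q -> qregular (a * q / b) q -> qregular (c * q) q -> qregular d q ->
  Csum (fun k =>
     phi43_term a b (c / q) (d * q) (a * q / b) (c * q) d q (- (q / b)) k
     - (a + b - a * q - a * b) / (b - a * q) * bd_term (a * q) b q k) n
  = a / q * (qpoch c q n * qpoch (a * q) q n * qpoch b q (S n)
      / (qpoch (c * q) q n * qpoch q q n * qpoch (a * q / b) q (S n)))
     * (- (q / b)) ^ S n.
Proof.
intros c d Hq0 Hb Hab Hq Hd Hc Hdr.
assert (Hc1 : forall k, (a + b) - (q + b) * a * q * q ^ k <> 0). {
  intros k Z. apply (Hc k). unfold c.
  replace (1 - (q + b) * a / (a + b) * q * q ^ k)
    with (((a + b) - (q + b) * a * q * q ^ k) / (a + b)) by (field; assumption).
  rewrite Z. field. assumption. }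
assert (Hd1 : forall k, (a + b) - (1 + b) * a * q ^ k <> 0). {
  intros k Z. apply (Hdr k). unfold d.
  replace (1 - (1 + b) * a / (a + b) * q ^ k)
    with (((a + b) - (1 + b) * a * q ^ k) / (a + b)) by (field; assumption).
  rewrite Z. field. assumption. }
assert (Ha : 1 - a <> 0). {
  intros Z. apply (Hd1 0%nat). simpl.
  replace (a + b - (1 + b) * a * 1) with (b * (1 - a)) by ring. rewrite Z. ring. }
pose proof (regular_cleared a b q 0 Hb (Hd 0%nat)) as H0. simpl in H0. rewrite Cmult_1_r in H0.
revert n. apply Csum_telescope.
- rewrite bd_term_shift by assumption. unfold phi43_term. simpl. field.
  repeat split; assumption.
- intros n. rewrite bd_term_shift by assumption. unfold phi43_term.
  assert (Ed : qpoch (d * q) q (S n) = qpoch d q (S n) * (1 - d * q ^ S n) / (1 - d)). {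
    assert (1 - d <> 0). { pose proof (Hdr 0%nat) as Z. simpl in Z. now rewrite Cmult_1_r in Z. }
    rewrite <- qpoch_S, (qpoch_shift d). field. assumption. }
  assert (Ec : qpoch (c / q) q (S n) = (1 - c / q) * qpoch c q n). {
    rewrite qpoch_shift. replace (c / q * q) with c by (field; assumption). reflexivity. }
  assert (Ec' : qpoch c q n * (1 - c * q ^ n) = (1 - c) * qpoch (c * q) q n)
    by (rewrite <- qpoch_shift; reflexivity).
  rewrite Ed, Ec.
  rewrite (qpoch_shift a), (qpoch_S c q n), (qpoch_S (c * q) q n), (qpoch_S (a * q / b) q (S n)),
   (qpoch_S (a * q / b) q n), (qpoch_S (a * q) q n),
   (qpoch_S b q (S n)), (qpoch_S q q n), !Cpow_S.
  pose proof (regular_cleared a b q n Hb (Hd n)) as H1.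
  pose proof (regular_cleared a b q (S n) Hb (Hd (S n))) as H2.
  pose proof (qregular_neq_0 _ _ n Hq) as H3. pose proof (qregular_neq_0 _ _ n Hd) as H4.
  pose proof (qregular_neq_0 _ _ n Hc) as H5. pose proof (qregular_neq_0 _ _ (S n) Hdr) as H6.
  pose proof (Hq n) as H7. pose proof (Hc1 n) as H8.
  clear Ed Ec.
  set (Dd := qpoch d q (S n)) in *.
  rewrite !Cpow_S in *.
  set (X := q ^ n) in *. set (D := qpoch (a * q / b) q n) in *.
  set (Dc := qpoch (c * q) q n) in *. set (Nc := qpoch c q n) in *.
  (* The numerator of the constant is [(1-c)(a+b)]; trading [1-c] for
     [(c;q)_n (1 - c q^n) / (cq;q)_n] makes all three terms multiples of
     [(c;q)_n], and the rest is a rational identity in [q^n]. *)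
  assert (Ek : (a + b - a * q - a * b) / (b - a * q)
     = Nc * (1 - c * X) / Dc * ((a + b) / (b - a * q))). {
    rewrite Ec'. unfold c. field. repeat split; assumption. }
  rewrite Ek. clear Ek Ec'.
  assert (Hcd : a + b - (1 + b) * a <> 0) by (pose proof (Hd1 0%nat) as Z; simpl in Z; now rewrite Cmult_1_r in Z).
  assert (Hbq : b - a * q <> 0) by assumption.
  clearbody Dc Nc Dd D X. unfold c, d.
  field. repeat split; try assumption.
Qed.

(** * Limits of complex sequences *)

(** Convergence through the modulus reduces limits in [C] to real ones;
    [tends_filterlim] connects it with the uniform structure of [C]. *)
Definition tends (u : nat -> C) (l : C) : Prop :=
  is_lim_seq (fun n => Cmod (u n - l)) 0%R.

Lemma tends_filterlim (u : nat -> C) (l : C) :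
  tends u l <-> filterlim u eventually (@locally C_UniformSpace l).
Proof.
rewrite (filterlim_locally_ball_norm (K := C_AbsRing) (U := C_NormedModule) u l).
unfold tends. rewrite <- is_lim_seq_spec. unfold is_lim_seq', ball_norm.
split; intros H eps; destruct (H eps) as [N HN]; exists N; intros n Hn;
  specialize (HN n Hn); change (norm (minus (u n) l)) with (Cmod (u n - l)) in *.
- rewrite Rminus_0_r, Rabs_pos_eq in HN by apply Cmod_ge_0. exact HN.
- rewrite Rminus_0_r, Rabs_pos_eq by apply Cmod_ge_0. exact HN.
Qed.

Lemma tends_of_bound (u : nat -> C) (l : C) (v : nat -> R) :
  (forall n, Cmod (u n - l) <= v n)%R -> is_lim_seq v 0%R -> tends u l.
Proof.
intros H Hv. apply is_lim_seq_le_le with (u := fun _ => 0%R) (w := v).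
- intros n. split; [apply Cmod_ge_0 | apply H].
- apply is_lim_seq_const.
- exact Hv.
Qed.

Lemma tends_ext (u v : nat -> C) (l : C) :
  (forall n, u n = v n) -> tends u l -> tends v l.
Proof. intros E. apply is_lim_seq_ext. intros n. now rewrite E. Qed.

Lemma tends_const (l : C) : tends (fun _ => l) l.
Proof.
apply tends_of_bound with (v := fun _ => 0%R); [|apply is_lim_seq_const].
intros _. replace (l - l) with (RtoC 0) by ring. rewrite Cmod_0. lra.
Qed.

Lemma tends_plus (u v : nat -> C) (l m : C) :
  tends u l -> tends v m -> tends (fun n => u n + v n) (l + m).
Proof.
intros Hu Hv.
apply tends_of_bound with (v := fun n => (Cmod (u n - l) + Cmod (v n - m))%R).
- intros n. replace (u n + v n - (l + m)) with (u n - l + (v n - m)) by ring.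
  apply Cmod_triangle.
- replace (Finite 0) with (Finite (0 + 0)) by (f_equal; ring).
  now apply is_lim_seq_plus'.
Qed.

Lemma tends_mult (u v : nat -> C) (l m : C) :
  tends u l -> tends v m -> tends (fun n => u n * v n) (l * m).
Proof.
intros Hu Hv.
apply tends_of_bound with (v := fun n =>
  (Cmod (u n - l) * Cmod (v n - m) + Cmod (u n - l) * Cmod m
   + Cmod l * Cmod (v n - m))%R).
- intros n.
  replace (u n * v n - l * m)
    with ((u n - l) * (v n - m) + (u n - l) * m + l * (v n - m)) by ring.
  rewrite <- !Cmod_mult.
  eapply Rle_trans; [apply Cmod_triangle|].
  apply Rplus_le_compat_r, Cmod_triangle.
- replace (Finite 0) with (Finite (0 * 0 + 0 * Cmod m + Cmod l * 0)) by (f_equal; ring).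
  repeat first [apply is_lim_seq_plus' | apply is_lim_seq_mult' | assumption | apply is_lim_seq_const].
Qed.

Lemma tends_scal (c : C) (u : nat -> C) (l : C) :
  tends u l -> tends (fun n => c * u n) (c * l).
Proof. apply tends_mult, tends_const. Qed.

Lemma tends_minus (u v : nat -> C) (l m : C) :
  tends u l -> tends v m -> tends (fun n => u n - v n) (l - m).
Proof.
intros Hu Hv. apply tends_ext with (fun n => u n + - (1) * v n).
- intros n. ring.
- replace (l - m) with (l + - (1) * m) by ring.
  apply tends_plus; [assumption | now apply tends_scal].
Qed.

Lemma tends_unique (u : nat -> C) (l m : C) : tends u l -> tends u m -> l = m.
Proof.
intros Hl Hm. pose proof (tends_minus _ _ _ _ Hl Hm) as H.
assert (E : Finite (Cmod (0 - (l - m))) = Finite 0). {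
  transitivity (Lim_seq (fun n => Cmod (u n - u n - (l - m)))).
  - symmetry. apply is_lim_seq_unique.
    apply is_lim_seq_ext with (fun _ => Cmod (0 - (l - m))); [|apply is_lim_seq_const].
    intros n. f_equal. ring.
  - now apply is_lim_seq_unique. }
injection E as E. apply Cmod_eq_0 in E.
replace l with (m - (0 - (l - m))) by ring. rewrite E. ring.
Qed.

Lemma tends_subseq (u : nat -> C) (l : C) (f : nat -> nat) :
  (forall n, (f n < f (S n))%nat) -> tends u l -> tends (fun n => u (f n)) l.
Proof.
intros Hf Hu.
apply (is_lim_seq_subseq (fun n => Cmod (u n - l)) _ f); [|exact Hu].
now apply eventually_subseq.
Qed.

Lemma geom_tends (M r : R) : (0 <= r < 1)%R -> is_lim_seq (fun n => (M * r ^ n)%R) 0%R.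
Proof.
intros Hr. replace (Finite 0) with (Finite (M * 0)) by (f_equal; ring).
apply is_lim_seq_mult'; [apply is_lim_seq_const|].
apply is_lim_seq_geom. rewrite Rabs_pos_eq; lra.
Qed.

(** * Bounded sequences and dominated series *)

Definition bounded_seq (u : nat -> C) : Prop :=
  exists M : R, (0 <= M)%R /\ forall n, (Cmod (u n) <= M)%R.

Lemma bounded_const (c : C) : bounded_seq (fun _ => c).
Proof. exists (Cmod c). split; [apply Cmod_ge_0 | intros _; lra]. Qed.

Lemma bounded_mult (u v : nat -> C) :
  bounded_seq u -> bounded_seq v -> bounded_seq (fun n => u n * v n).
Proof.
intros [M [HM Hu]] [K [HK Hv]]. exists (M * K)%R. split.
- now apply Rmult_le_pos.
- intros n. rewrite Cmod_mult. apply Rmult_le_compat; auto using Cmod_ge_0.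
Qed.

Lemma bounded_S (u : nat -> C) : bounded_seq u -> bounded_seq (fun n => u (S n)).
Proof. intros [M [HM Hu]]. exists M. split; [assumption | intros n; apply Hu]. Qed.

(** Finitely many initial terms do not affect boundedness. *)
Lemma bounded_from (u : nat -> C) (m : nat) :
  bounded_seq (fun n => u (m + n)%nat) -> bounded_seq u.
Proof.
induction m as [|m IH]; intros H.
- exact H.
- apply IH. destruct H as [M [HM Hu]].
  exists (Rmax M (Cmod (u m))). split.
  + eapply Rle_trans; [exact HM | apply Rmax_l].
  + intros [|n].
    * rewrite Nat.add_0_r. apply Rmax_r.
    * rewrite Nat.add_succ_r. eapply Rle_trans; [apply Hu | apply Rmax_l].
Qed.

Lemma tends_geom_0 (u : nat -> C) (z : C) :
  bounded_seq u -> (Cmod z < 1)%R -> tends (fun n => u n * z ^ S n) 0.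
Proof.
intros [M [HM Hu]] Hz. pose proof (Cmod_ge_0 z) as Hz0.
apply tends_of_bound with (v := fun n => (M * Cmod z ^ n)%R).
- intros n. replace (u n * z ^ S n - 0) with (u n * z ^ S n) by ring.
  rewrite Cmod_mult, Cmod_pow. apply Rmult_le_compat; try apply Cmod_ge_0; try apply Hu.
  + apply pow_le, Cmod_ge_0.
  + simpl. rewrite <- (Rmult_1_l (Cmod z ^ n)) at 2.
    apply Rmult_le_compat_r; [now apply pow_le | lra].
- apply geom_tends. lra.
Qed.

Lemma geom_dominated (u : nat -> C) (M r : R) :
  (0 <= M)%R -> (0 <= r < 1)%R -> (forall n, Cmod (u n) <= M * r ^ n)%R ->
  exists s, tends (Csum u) s.
Proof.
intros HM Hr Hu.
assert (Hb : ex_series (fun n => (M * r ^ n)%R)).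
{ apply (ex_series_scal (K := R_AbsRing) (V := R_NormedModule) M (fun n => (r ^ n)%R)).
  apply ex_series_geom. rewrite Rabs_pos_eq; lra. }
destruct (ex_series_le (K := C_AbsRing) (V := C_CompleteNormedModule) u _ Hu Hb) as [s Hs].
exists s. apply tends_filterlim. exact Hs.
Qed.

Lemma geom_sum_bound (u : nat -> C) (M r : R) (s : C) :
  (0 <= M)%R -> (0 <= r < 1)%R -> (forall n, Cmod (u n) <= M * r ^ n)%R ->
  tends (Csum u) s -> (Cmod s <= M / (1 - r))%R.
Proof.
intros HM Hr Hu Hs.
assert (Hp : forall n, (Cmod (Csum u n) <= M / (1 - r) * (1 - r ^ S n))%R).
{ induction n as [|n IH].
  - rewrite Csum_0. specialize (Hu 0%nat). simpl in Hu |- *.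
    replace (M / (1 - r) * (1 - r * 1))%R with (M * 1)%R by (field; lra). exact Hu.
  - rewrite Csum_S. eapply Rle_trans; [apply Cmod_triangle|].
    specialize (Hu (S n)).
    replace (M / (1 - r) * (1 - r ^ S (S n)))%R
      with (M / (1 - r) * (1 - r ^ S n) + M * r ^ S n)%R by (simpl; field; lra).
    lra. }
assert (Hp' : forall n, (Cmod s <= M / (1 - r) + Cmod (Csum u n - s))%R).
{ intros n. replace s with (Csum u n - (Csum u n - s)) at 1 by ring.
  unfold Cminus at 1. eapply Rle_trans; [apply Cmod_triangle|].
  rewrite Cmod_opp. apply Rplus_le_compat_r. eapply Rle_trans; [apply Hp|].
  rewrite <- (Rmult_1_r (M / (1 - r))) at 2. apply Rmult_le_compat_l.
  - apply Rmult_le_pos; [lra | left; apply Rinv_0_lt_compat; lra].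
  - assert (0 <= r ^ S n)%R by (apply pow_le; lra). lra. }
apply (is_lim_seq_le (fun _ => Cmod s) (fun n => (M / (1 - r) + Cmod (Csum u n - s))%R)
   (Cmod s) (M / (1 - r))%R Hp').
- apply is_lim_seq_const.
- replace (Finite (M / (1 - r))) with (Finite (M / (1 - r) + 0)) by (f_equal; ring).
  apply is_lim_seq_plus'; [apply is_lim_seq_const | exact Hs].
Qed.

Lemma power_series_converges (u : nat -> C) (z : C) :
  bounded_seq u -> (Cmod z < 1)%R -> exists s, tends (Csum (fun n => u n * z ^ n)) s.
Proof.
intros [M [HM Hu]] Hz. apply geom_dominated with M (Cmod z).
- exact HM.
- split; [apply Cmod_ge_0 | exact Hz].
- intros n. rewrite Cmod_mult, Cmod_pow. apply Rmult_le_compat_r; [apply pow_le, Cmod_ge_0 | apply Hu].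
Qed.

Lemma Csum_ext (u v : nat -> C) (n : nat) :
  (forall k, u k = v k) -> Csum u n = Csum v n.
Proof. intros E. induction n as [|n IH]; rewrite ?Csum_0, ?Csum_S, ?IH, ?E; reflexivity. Qed.

Lemma Csum_lin (c d : C) (u v : nat -> C) (n : nat) :
  Csum (fun k => c * u k - d * v k) n = c * Csum u n - d * Csum v n.
Proof. induction n as [|n IH]; rewrite ?Csum_0, ?Csum_S, ?IH; ring. Qed.

(** * Bounds on the shifted factorial *)

(** Induction with the sharper bound [K (1 - |p|^n)], [K = 2|x|/(1-|p|)]: since
    [K <= 1/2] the current product has modulus at most 2, so the next factor
    moves it by at most [2 |x| |p|^n = K (1-|p|) |p|^n]. *)
Lemma qpoch_near_1 (x p : C) (n : nat) :
  (Cmod p < 1)%R -> (Cmod x <= (1 - Cmod p) / 4)%R ->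
  (Cmod (qpoch x p n - 1) <= 2 * Cmod x / (1 - Cmod p))%R.
Proof.
intros Hp Hx. set (r := Cmod p) in *. set (t := Cmod x) in *.
assert (Hr : (0 <= r)%R) by apply Cmod_ge_0. assert (Ht : (0 <= t)%R) by apply Cmod_ge_0.
set (K := (2 * t / (1 - r))%R).
assert (HK : (0 <= K <= 1 / 2)%R).
{ unfold K. split.
  - apply Rmult_le_pos; [lra | left; apply Rinv_0_lt_compat; lra].
  - apply Rmult_le_reg_r with (1 - r)%R; [lra|].
    unfold Rdiv at 1. rewrite Rmult_assoc, Rinv_l by lra. lra. }
assert (HKr : (K * (1 - r) = 2 * t)%R) by (unfold K; field; lra).
assert (H : forall m, (Cmod (qpoch x p m - 1) <= K * (1 - r ^ m))%R).
{ induction m as [|m IH].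
  - simpl. replace (1 - 1) with (RtoC 0) by ring. rewrite Cmod_0. lra.
  - rewrite qpoch_S.
    replace (qpoch x p m * (1 - x * p ^ m) - 1)
      with ((qpoch x p m - 1) + (- (x * p ^ m) * (1 + (qpoch x p m - 1)))) by ring.
    eapply Rle_trans; [apply Cmod_triangle|].
    rewrite Cmod_mult, Cmod_opp, Cmod_mult, Cmod_pow. fold r t.
    assert (Hrm : (0 <= r ^ m)%R) by now apply pow_le.
    assert (Hc : (Cmod (1 + (qpoch x p m - 1)) <= 2)%R).
    { eapply Rle_trans; [apply Cmod_triangle|]. rewrite Cmod_1.
      assert (0 <= K * r ^ m)%R by (apply Rmult_le_pos; lra). lra. }
    assert (t * r ^ m * Cmod (1 + (qpoch x p m - 1)) <= t * r ^ m * 2)%R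
      by (apply Rmult_le_compat_l; [now apply Rmult_le_pos | exact Hc]).
    replace (K * (1 - r ^ S m))%R with (K * (1 - r ^ m) + r ^ m * (K * (1 - r)))%R
      by (simpl; ring).
    rewrite HKr. lra. }
eapply Rle_trans; [apply H|].
assert (0 <= K * r ^ n)%R by (apply Rmult_le_pos; [lra | now apply pow_le]). lra.
Qed.

Lemma qpoch_near_half (x p : C) (n : nat) :
  (Cmod p < 1)%R -> (Cmod x <= (1 - Cmod p) / 4)%R ->
  (1 / 2 <= Cmod (qpoch x p n) <= 3 / 2)%R.
Proof.
intros Hp Hx. pose proof (qpoch_near_1 x p n Hp Hx) as H.
assert (2 * Cmod x / (1 - Cmod p) <= 1 / 2)%R.
{ apply Rmult_le_reg_r with (1 - Cmod p)%R; [lra|].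
  unfold Rdiv at 1. rewrite Rmult_assoc, Rinv_l by lra. lra. }
pose proof (Cmod_triangle 1 (qpoch x p n - 1)) as H1.
pose proof (Cmod_triangle (qpoch x p n) (- (qpoch x p n - 1))) as H2.
rewrite Cmod_opp in H2.
replace (1 + (qpoch x p n - 1)) with (qpoch x p n) in H1 by ring.
replace (qpoch x p n + - (qpoch x p n - 1)) with (RtoC 1) in H2 by ring.
rewrite Cmod_1 in H1, H2. lra.
Qed.

Lemma eventually_small (x p : C) (e : R) :
  (Cmod p < 1)%R -> (0 < e)%R -> exists m, (Cmod (x * p ^ m) <= e)%R.
Proof.
intros Hp He.
pose proof (geom_tends (Cmod x) (Cmod p) (conj (Cmod_ge_0 p) Hp)) as H.
rewrite <- is_lim_seq_spec in H. destruct (H (mkposreal e He)) as [m Hm].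
exists m. specialize (Hm m (le_n m)). simpl in Hm.
rewrite Rminus_0_r in Hm. apply Rabs_def2 in Hm.
rewrite Cmod_mult, Cmod_pow. lra.
Qed.

Lemma qpoch_bounded (x p : C) : (Cmod p < 1)%R -> bounded_seq (qpoch x p).
Proof.
intros Hp. destruct (eventually_small x p ((1 - Cmod p) / 4) Hp) as [m Hm]; [lra|].
apply bounded_from with m.
destruct (bounded_mult (fun _ => qpoch x p m) (qpoch (x * p ^ m) p)) as [M HM].
- apply bounded_const.
- exists (3 / 2)%R. split; [lra | intros n; now apply qpoch_near_half].
- exists M. split; [apply HM | intros n; rewrite qpoch_split; apply HM].
Qed.

(** For large [m] the tail product starts at a small [x p^m] and stays above 1/2
    in modulus; the first [m] factors are a nonzero constant. *)
Lemma qpoch_inv_bounded (x p : C) :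
  (Cmod p < 1)%R -> qregular x p -> bounded_seq (fun n => / qpoch x p n).
Proof.
intros Hp Hx. destruct (eventually_small x p ((1 - Cmod p) / 4) Hp) as [m Hm]; [lra|].
apply bounded_from with m.
destruct (bounded_mult (fun _ => / qpoch x p m) (fun n => / qpoch (x * p ^ m) p n)) as [M HM].
- apply bounded_const.
- exists 2%R. split; [lra | intros n].
  rewrite Cmod_inv by (apply qregular_neq_0; now apply qregular_shift).
  replace 2%R with (/ (1 / 2))%R by field. apply Rinv_le_contravar; [lra|].
  now apply qpoch_near_half.
- exists M. split; [apply HM | intros n; rewrite qpoch_split].
  pose proof (qregular_neq_0 _ _ m Hx).
  pose proof (qregular_neq_0 _ _ n (qregular_shift _ _ m Hx)).
  replace (/ (qpoch x p m * qpoch (x * p ^ m) p n))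
    with (/ qpoch x p m * / qpoch (x * p ^ m) p n) by (field; split; assumption).
  apply HM.
Qed.

(** The increments [-x p^n (x;p)_n] are dominated by a geometric sequence. *)
Lemma qpoch_tends (x p : C) : (Cmod p < 1)%R -> tends (qpoch x p) (qpoch_inf x p).
Proof.
intros Hp. destruct (qpoch_bounded x p Hp) as [M [HM Hb]].
destruct (geom_dominated (fun n => qpoch x p (S n) - qpoch x p n) (M * Cmod x) (Cmod p))
  as [s Hs].
- apply Rmult_le_pos; [exact HM | apply Cmod_ge_0].
- split; [apply Cmod_ge_0 | exact Hp].
- intros n. rewrite qpoch_S.
  replace (qpoch x p n * (1 - x * p ^ n) - qpoch x p n)
    with (- (qpoch x p n * x * p ^ n)) by ring.
  rewrite Cmod_opp, !Cmod_mult, Cmod_pow.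
  apply Rmult_le_compat_r; [apply pow_le, Cmod_ge_0|].
  apply Rmult_le_compat_r; [apply Cmod_ge_0 | apply Hb].
- assert (H : tends (qpoch x p) (s + 1)).
  { apply is_lim_seq_incr_1.
    apply (tends_ext (fun n => Csum (fun n => qpoch x p (S n) - qpoch x p n) n + 1)
      (fun n => qpoch x p (S n))).
    - intros n.
      rewrite (Csum_telescope _ (fun n => qpoch x p (S n) - 1)).
      + ring.
      + reflexivity.
      + intros k. ring.
    - apply tends_plus; [exact Hs | apply tends_const]. }
  replace (qpoch_inf x p) with (s + 1); [exact H|].
  symmetry. apply qpoch_inf_unique, tends_filterlim, H.
Qed.

(** A null sequence cannot have bounded inverses. *)
Lemma qpoch_inf_neq_0 (x p : C) :
  (Cmod p < 1)%R -> qregular x p -> qpoch_inf x p <> 0.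
Proof.
intros Hp Hx Z. destruct (qpoch_inv_bounded x p Hp Hx) as [M [HM Hb]].
pose proof (qpoch_tends x p Hp) as H. rewrite Z in H.
apply C1_nz, (tends_unique (fun n => qpoch x p n * / qpoch x p n)).
- apply tends_ext with (fun _ => RtoC 1); [|apply tends_const].
  intros n. field. now apply qregular_neq_0.
- apply tends_of_bound with (fun n => (Cmod (qpoch x p n - 0) * M)%R).
  + intros n. replace (qpoch x p n * / qpoch x p n - 0) with ((qpoch x p n - 0) * / qpoch x p n) by ring.
    rewrite Cmod_mult. apply Rmult_le_compat_l; [apply Cmod_ge_0 | apply Hb].
  + replace (Finite 0) with (Finite (0 * M)) by (f_equal; ring).
    apply is_lim_seq_mult'; [exact H | apply is_lim_seq_const].
Qed.

Lemma qregular_small (x p : C) : (Cmod p < 1)%R -> (Cmod x < 1)%R -> qregular x p.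
Proof.
intros Hp Hx k Z.
assert (E : Cmod (x * p ^ k) = 1%R).
{ replace (x * p ^ k) with (1 - (1 - x * p ^ k)) by ring. rewrite Z.
  replace (1 - 0) with (RtoC 1) by ring. apply Cmod_1. }
rewrite Cmod_mult, Cmod_pow in E.
assert (Cmod p ^ k <= 1)%R.
{ rewrite <- (pow1 k). apply pow_incr. split; [apply Cmod_ge_0 | lra]. }
assert (0 <= Cmod p ^ k)%R by apply pow_le, Cmod_ge_0.
pose proof (Cmod_ge_0 x).
assert (Cmod x * Cmod p ^ k <= Cmod x * 1)%R by (apply Rmult_le_compat_l; lra). lra.
Qed.

(** * The q-binomial theorem and the Bailey-Daum summation *)

Lemma tends_from (u : nat -> C) (l : C) (m : nat) :
  tends (fun n => u (n + m)%nat) l <-> tends u l.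
Proof. symmetry. apply (is_lim_seq_incr_n (fun n => Cmod (u n - l))). Qed.

(** How a functional equation becomes an infinite product: [N] applications of
    it relate [s] to a value [t] of the same function at an argument closer to
    0, and these values tend to [s0] at a geometric rate. *)
Lemma iteration_limit (P Q : nat -> C) (p l s s0 : C) (K r : R) (m : nat) :
  tends P p -> tends Q l -> (0 <= r < 1)%R ->
  (forall N, (m <= N)%nat ->
     exists t, s * P N = Q N * t /\ (Cmod (t - s0) <= K * r ^ N)%R) ->
  s * p = l * s0.
Proof.
intros HP HQ Hr H.
apply (tends_unique (fun n => s * P n)); [now apply tends_scal|].
assert (H0 : tends (fun n => s * P n - Q n * s0) 0).
{ apply (tends_from _ _ m).
  apply tends_of_bound with
    (fun n => (Cmod (Q (n + m)%nat - l) * (K * r ^ (n + m)) + Cmod l * (K * r ^ (n + m)))%R).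
  - intros n. destruct (H (n + m)%nat) as [t [E Ht]]; [lia|]. rewrite E.
    replace (Q (n + m)%nat * t - Q (n + m)%nat * s0 - 0)
      with ((Q (n + m)%nat - l) * (t - s0) + l * (t - s0)) by ring.
    eapply Rle_trans; [apply Cmod_triangle|]. rewrite !Cmod_mult.
    apply Rplus_le_compat; apply Rmult_le_compat_l; auto using Cmod_ge_0.
  - apply (is_lim_seq_incr_n (fun n => (Cmod (Q n - l) * (K * r ^ n) + Cmod l * (K * r ^ n))%R) m).
    replace (Finite 0) with (Finite (0 * 0 + Cmod l * 0)) by (f_equal; ring).
    repeat first [apply is_lim_seq_plus' | apply is_lim_seq_mult' | exact HQ
      | apply is_lim_seq_const | now apply geom_tends]. 
    }
apply tends_ext with (fun n => (s * P n - Q n * s0) + Q n * s0).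
- intros n. ring.
- replace (l * s0) with (0 + l * s0) by ring.
  apply tends_plus; [exact H0|]. apply tends_mult; [exact HQ | apply tends_const].
Qed.

(** A certificate with boundary term [h n * z ^ S n] yields an equation between
    the sums, because that boundary term tends to 0. *)
Lemma balance_of_telescope (u v h : nat -> C) (al be z s t : C) :
  (Cmod z < 1)%R -> bounded_seq h ->
  (forall n, Csum (fun k => al * u k - be * v k) n = h n * z ^ S n) ->
  tends (Csum u) s -> tends (Csum v) t -> al * s = be * t.
Proof.
intros Hz Hh E Hu Hv.
assert (H : al * s - be * t = 0).
{ apply (tends_unique (fun n => h n * z ^ S n)); [|now apply tends_geom_0].
  apply tends_ext with (fun n => al * Csum u n - be * Csum v n).
  - intros n. now rewrite <- E, Csum_lin.
  - apply tends_minus; now apply tends_scal. }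
replace (al * s) with (al * s - be * t + be * t) by ring. rewrite H. ring.
Qed.

Ltac bdd :=
  lazymatch goal with
  | |- bounded_seq (fun _ => ?c) => apply bounded_const
  | |- bounded_seq (fun n => _ * _) => apply bounded_mult; bdd
  | |- bounded_seq (fun n => _ / _) => apply bounded_mult; bdd
  | |- bounded_seq (fun n => qpoch ?x ?p (S (@?f n))) => apply (bounded_S (fun n => qpoch x p (f n))); bdd
  | |- bounded_seq (fun n => / qpoch ?x ?p (S (@?f n))) => apply (bounded_S (fun n => / qpoch x p (f n))); bdd
  | |- bounded_seq (fun n => qpoch _ _ n) => apply qpoch_bounded; assumption
  | |- bounded_seq (fun n => / qpoch _ _ n) => apply qpoch_inv_bounded; assumption
  | |- bounded_seq (qpoch _ _) => apply qpoch_bounded; assumption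
  end.

(** The relation [(1-z) g(z) = (1-bz) g(zq)] for the sum [g] is iterated; the
    limit is [g(0) = 1].  For [n > 0] the term of [g(z q^N)] carries [q^(Nn)],
    of modulus at most [|q|^N], which makes [g(z q^N) - 1] of order [|q|^N]. *)
Lemma qbinomial (b q z s : C) :
  (Cmod q < 1)%R ->
  (Cmod z < 1)%R -> tends (Csum (binom_term b q z)) s ->
  s * qpoch_inf z q = qpoch_inf (b * z) q.
Proof.
intros Hq1 Hz Hs. pose proof (qregular_small q q Hq1 Hq1) as Hq.
assert (Hsmall : forall N, (Cmod (z * q ^ N) < 1)%R).
{ intros N. rewrite Cmod_mult, Cmod_pow.
  assert (Cmod q ^ N <= 1)%R.
  { rewrite <- (pow1 N). apply pow_incr. split; [apply Cmod_ge_0 | lra]. }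
  assert (Cmod z * Cmod q ^ N <= Cmod z * 1)%R
    by (apply Rmult_le_compat_l; [apply Cmod_ge_0 | assumption]). lra. }
assert (Hbd : bounded_seq (fun n => qpoch b q n / qpoch q q n)) by (apply bounded_mult; bdd).
assert (Hit : forall N, exists t, tends (Csum (binom_term b q (z * q ^ N))) t
   /\ s * qpoch z q N = qpoch (b * z) q N * t).
{ induction N as [|N [t [Ht E]]].
  - exists s. simpl. rewrite Cmult_1_r. split; [exact Hs | ring].
  - destruct (power_series_converges _ (z * q ^ S N) Hbd (Hsmall _)) as [t' Ht'].
    exists t'. split; [exact Ht'|].
    assert (B : (1 - z * q ^ N) * t = (1 - b * (z * q ^ N)) * t').
    { apply balance_of_telescope with (binom_term b q (z * q ^ N)) (binom_term b q (z * q ^ S N))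
        (fun n => - (1) * (qpoch b q (S n) * / qpoch q q n)) (z * q ^ N).
      - apply Hsmall.
      - bdd.
      - intros n. replace (z * q ^ S N) with (z * q ^ N * q) by (rewrite Cpow_S; ring).
        rewrite binom_telescope by exact Hq. unfold Cdiv. ring.
      - exact Ht.
      - exact Ht'. }
    rewrite !qpoch_S. transitivity ((1 - z * q ^ N) * (s * qpoch z q N)); [ring|].
    rewrite E. transitivity (qpoch (b * z) q N * ((1 - z * q ^ N) * t)); [ring|].
    rewrite B. ring. }
destruct Hbd as [M [HM Hbd]].
rewrite <- (Cmult_1_r (qpoch_inf (b * z) q)).
apply (iteration_limit (qpoch z q) (qpoch (b * z) q) _ _ s 1 (M / (1 - Cmod z)) (Cmod q) 0).
- now apply qpoch_tends.
- now apply qpoch_tends.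
- split; [apply Cmod_ge_0 | assumption].
- intros N _. destruct (Hit N) as [t [Ht E]]. exists t. split; [exact E|].
  replace (M / (1 - Cmod z) * Cmod q ^ N)%R with (M * Cmod q ^ N / (1 - Cmod z))%R
    by (field; lra).
  assert (Hqn : (0 <= Cmod q ^ N)%R) by (apply pow_le, Cmod_ge_0).
  apply geom_sum_bound with
    (fun n => binom_term b q (z * q ^ N) n - (if n then RtoC 1 else RtoC 0)).
  + now apply Rmult_le_pos.
  + split; [apply Cmod_ge_0 | assumption].
  + intros n. destruct n as [|n].
    * unfold binom_term. simpl.
      replace (1 / 1 * 1 - 1) with (RtoC 0) by field. rewrite Cmod_0.
      rewrite Rmult_1_r. now apply Rmult_le_pos.
    * replace (binom_term b q (z * q ^ N) (S n) - 0)
        with (qpoch b q (S n) / qpoch q q (S n) * q ^ N * ((q ^ N) ^ n * z ^ S n))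
        by (unfold binom_term; rewrite Cpow_mult_l, (Cpow_S (q ^ N)); ring).
      rewrite !Cmod_mult, !Cmod_pow. apply Rmult_le_compat.
      { apply Rmult_le_pos; [apply Cmod_ge_0 | assumption]. }
      { apply Rmult_le_pos; apply pow_le; [assumption | apply Cmod_ge_0]. }
      { apply Rmult_le_compat_r; [assumption | apply Hbd]. }
      { rewrite <- (Rmult_1_l (Cmod z ^ S n)) at 2.
        apply Rmult_le_compat_r; [apply pow_le, Cmod_ge_0|].
        rewrite <- (pow1 n). apply pow_incr. split; [assumption|].
        rewrite <- (pow1 N). apply pow_incr. split; [apply Cmod_ge_0 | lra]. }
  + apply tends_ext with (fun n => 1 * Csum (binom_term b q (z * q ^ N)) n
      - 1 * Csum (fun n => if n then RtoC 1 else RtoC 0) n).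
    * intros n. rewrite <- Csum_lin. apply Csum_ext. intros k. ring.
    * replace (t - 1) with (1 * t - 1 * 1) by ring.
      apply tends_minus; apply tends_scal; [exact Ht|].
      apply tends_ext with (fun _ => RtoC 1); [|apply tends_const].
      intros n. symmetry. apply (Csum_telescope _ (fun _ => RtoC 1)); [reflexivity | intros; ring].
Qed.

Lemma bd_summable (a b q : C) :
  (Cmod q < 1)%R -> (Cmod (q / b) < 1)%R ->
  qregular (a * q / b) q -> exists s, tends (Csum (bd_term a b q)) s.
Proof.
intros Hq1 Hqb Hd. pose proof (qregular_small q q Hq1 Hq1) as Hq.
assert (Hz : (Cmod (- (q / b)) < 1)%R) by now rewrite Cmod_opp.
apply (power_series_converges
  (fun n => qpoch a q n * qpoch b q n / (qpoch q q n * qpoch (a * q / b) q n))); [|exact Hz].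
destruct (bounded_mult (fun n => qpoch a q n * qpoch b q n)
   (fun n => / qpoch q q n * / qpoch (a * q / b) q n)) as [M [HM H]]; [bdd | bdd |].
exists M. split; [exact HM|]. intros n.
replace (qpoch a q n * qpoch b q n / (qpoch q q n * qpoch (a * q / b) q n))
  with (qpoch a q n * qpoch b q n * (/ qpoch q q n * / qpoch (a * q / b) q n)).
- apply H.
- pose proof (qregular_neq_0 _ _ n Hq). pose proof (qregular_neq_0 _ _ n Hd).
  field. repeat split; assumption.
Qed.

Lemma bd_recurrence (a b q s t : C) :
  (Cmod q < 1)%R -> b <> 0 -> (Cmod (q / b) < 1)%R ->
  qregular (a * q / b) q ->
  tends (Csum (bd_term a b q)) s -> tends (Csum (bd_term (a * q ^ 2) b q)) t ->
  (1 - a * q / b) * (1 - a * q ^ 2 / b) * s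
  = (1 - a * q) * (1 - a * q ^ 2 / b ^ 2) * t.
Proof.
intros Hq1 Hb Hqb Hd Hs Ht. pose proof (qregular_small q q Hq1 Hq1) as Hq.
assert (Hz : (Cmod (- (q / b)) < 1)%R) by now rewrite Cmod_opp.
apply balance_of_telescope with (bd_term a b q) (bd_term (a * q ^ 2) b q)
  (fun n => (1 - a * q / b) * (1 - a * q ^ 2 / b) * (a * (1 - q / b))
     * ((qpoch (a * q) q n * qpoch b q (S n))
        * (/ qpoch q q n * / qpoch (a * q / b) q (S (S n))))) (- (q / b)).
- exact Hz.
- bdd.
- intros n.
  pose proof (bd_telescope a b q n Hb Hq Hd) as E.
  rewrite (Csum_ext _ (fun k => (1 - a * q / b) * (1 - a * q ^ 2 / b) * bd_term a b q k -
         (1 - a * q) * (1 - a * q ^ 2 / b ^ 2) * bd_term (a * q ^ 2) b q k)) in E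
    by (intros k; ring).
  rewrite E. pose proof (qregular_neq_0 _ _ n Hq) as H1. pose proof (qregular_neq_0 _ _ (S (S n)) Hd) as H2.
  set (D := qpoch (a * q / b) q (S (S n))) in *.
  set (Z := (- (q / b)) ^ S n). field. repeat split; assumption.
- exact Hs.
- exact Ht.
Qed.

Lemma bd_iteration (a b q s : C) (N : nat) :
  (Cmod q < 1)%R -> b <> 0 -> (Cmod (q / b) < 1)%R ->
  qregular (a * q / b) q -> tends (Csum (bd_term a b q)) s ->
  exists t, tends (Csum (bd_term (a * (q ^ 2) ^ N) b q)) t
   /\ s * qpoch (a * q / b) q (2 * N)
      = qpoch (a * q) (q ^ 2) N * qpoch (a * q ^ 2 / b ^ 2) (q ^ 2) N * t.
Proof.
intros Hq1 Hb Hqb Hd Hs. induction N as [|N [t [Ht E]]].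
- exists s. change ((q ^ 2) ^ 0) with (RtoC 1). rewrite Cmult_1_r. split; [exact Hs|].
  simpl. ring.
- assert (Hreg : forall k, qregular (a * (q ^ 2) ^ k * q / b) q).
  { intros k. rewrite <- Cpow_mult_r.
    replace (a * q ^ (2 * k) * q / b) with (a * q / b * q ^ (2 * k)) by (field; assumption).
    now apply qregular_shift. }
  destruct (bd_summable (a * (q ^ 2) ^ S N) b q Hq1 Hqb (Hreg _)) as [t' Ht'].
  exists t'. split; [exact Ht'|].
  replace (a * (q ^ 2) ^ S N) with (a * (q ^ 2) ^ N * q ^ 2) in Ht' by (rewrite (Cpow_S (q ^ 2)); ring).
  pose proof (bd_recurrence _ _ _ _ _ Hq1 Hb Hqb (Hreg N) Ht Ht') as B.
  replace (2 * S N)%nat with (S (S (2 * N))) by lia.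
  rewrite (qpoch_S _ _ (S _)), (qpoch_S _ _ (2 * N)), !(qpoch_S _ (q ^ 2)).
  rewrite (Cpow_S q (2 * N)), (Cpow_mult_r q 2 N).
  set (Y := (q ^ 2) ^ N) in *. set (D := qpoch (a * q / b) q (2 * N)) in *.
  transitivity ((1 - a * q / b * Y) * (1 - a * q / b * (q * Y)) * (s * D)); [ring|].
  rewrite E.
  replace ((1 - a * q / b * Y) * (1 - a * q / b * (q * Y)))
    with ((1 - a * Y * q / b) * (1 - a * Y * q ^ 2 / b)) by (field; assumption).
  set (Q1 := qpoch (a * q) (q ^ 2) N) in *. set (Q2 := qpoch (a * q ^ 2 / b ^ 2) (q ^ 2) N) in *.
  transitivity (Q1 * Q2 * ((1 - a * Y * q / b) * (1 - a * Y * q ^ 2 / b) * t)); [ring|].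
  rewrite B. field. assumption.
Qed.

(** The terms of [f(A)] and [f(0)] differ by the factor
    [(A;q)_n / (Aq/b;q)_n - 1 = (((A;q)_n - 1) - ((Aq/b;q)_n - 1)) / (Aq/b;q)_n],
    which is of order [|A|] uniformly in [n] by [qpoch_near_1]; as [|q/b| < 1],
    smallness of [A] entails that of [Aq/b]. *)
Lemma bd_near_0 (b q : C) :
  (Cmod q < 1)%R -> b <> 0 -> (Cmod (q / b) < 1)%R ->
  exists K : R, forall (A t s0 : C),
    qregular (A * q / b) q -> (Cmod A <= (1 - Cmod q) / 4)%R ->
    tends (Csum (bd_term A b q)) t ->
    tends (Csum (binom_term b q (- (q / b)))) s0 ->
    (Cmod (t - s0) <= K * Cmod A)%R.
Proof.
intros Hq1 Hb Hqb. pose proof (qregular_small q q Hq1 Hq1) as Hq.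
assert (Hz : (Cmod (- (q / b)) < 1)%R) by now rewrite Cmod_opp.
assert (Hbd : bounded_seq (fun n => qpoch b q n / qpoch q q n)) by (apply bounded_mult; bdd).
destruct Hbd as [M [HM Hbd]].
(* [8 = (2+2) * 2]: twice the bound of [qpoch_near_1], for [A] and for [Aq/b],
   times the bound 2 on the inverse of [(Aq/b;q)_n]. *)
exists (8 / (1 - Cmod q) * M / (1 - Cmod (- (q / b))))%R.
intros A t s0 Hd HA Ht Hs0.
assert (HI : (0 < / (1 - Cmod q))%R) by (apply Rinv_0_lt_compat; lra).
pose proof (Cmod_ge_0 A) as HA0.
replace (8 / (1 - Cmod q) * M / (1 - Cmod (- (q / b))) * Cmod A)%R
  with (8 / (1 - Cmod q) * Cmod A * M / (1 - Cmod (- (q / b))))%R by (field; lra).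
apply geom_sum_bound with (fun n => 1 * bd_term A b q n - 1 * binom_term b q (- (q / b)) n).
- apply Rmult_le_pos; [|assumption]. apply Rmult_le_pos; [|assumption].
  unfold Rdiv. lra.
- split; [apply Cmod_ge_0 | exact Hz].
- intros n. pose proof (qregular_neq_0 _ _ n Hq) as H1. pose proof (qregular_neq_0 _ _ n Hd) as H2.
  assert (HA' : (Cmod (A * q / b) <= Cmod A)%R).
  { replace (A * q / b) with (A * (q / b)) by (field; assumption). rewrite Cmod_mult.
    rewrite <- (Rmult_1_r (Cmod A)) at 2. apply Rmult_le_compat_l; lra. }
  pose proof (qpoch_near_1 A q n Hq1 HA) as N1.
  pose proof (qpoch_near_1 (A * q / b) q n Hq1 (Rle_trans _ _ _ HA' HA)) as N2.
  pose proof (qpoch_near_half (A * q / b) q n Hq1 (Rle_trans _ _ _ HA' HA)) as N3.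
  assert (N4 : (2 * Cmod (A * q / b) / (1 - Cmod q) <= 2 * Cmod A / (1 - Cmod q))%R)
    by (apply Rmult_le_compat_r; lra).
  set (D := qpoch (A * q / b) q n) in *.
  replace (1 * bd_term A b q n - 1 * binom_term b q (- (q / b)) n)
    with (((qpoch A q n - 1) - (D - 1)) * / D * (qpoch b q n / qpoch q q n) * (- (q / b)) ^ n).
  + rewrite Cmod_mult, Cmod_pow. apply Rmult_le_compat_r; [apply pow_le, Cmod_ge_0|].
    rewrite Cmod_mult. apply Rmult_le_compat; try apply Cmod_ge_0; [|apply Hbd].
    rewrite Cmod_mult, Cmod_inv by assumption.
    replace (8 / (1 - Cmod q) * Cmod A)%R with (4 * Cmod A / (1 - Cmod q) * / (1 / 2))%R by (field; lra).
    apply Rmult_le_compat.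
    * apply Cmod_ge_0.
    * left. apply Rinv_0_lt_compat. lra.
    * eapply Rle_trans; [apply Cmod_triangle|]. rewrite Cmod_opp.
      replace (4 * Cmod A / (1 - Cmod q))%R
        with (2 * Cmod A / (1 - Cmod q) + 2 * Cmod A / (1 - Cmod q))%R by (field; lra). lra.
    * apply Rinv_le_contravar; lra.
  + unfold bd_term, binom_term. fold D.
    set (Z := (- (q / b)) ^ n). field. repeat split; assumption.
- apply tends_ext with (fun n => 1 * Csum (bd_term A b q) n
      - 1 * Csum (binom_term b q (- (q / b))) n).
  + intros n. now rewrite Csum_lin.
  + replace (t - s0) with (1 * t - 1 * s0) by ring.
    apply tends_minus; now apply tends_scal.
Qed.

(** The Bailey-Daum summation.  After [N] steps the denominators of the
    recurrence form [(aq/b;q)_(2N)], while the numerators split into two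
    products with base [q^2]; this is where that base comes from. *)
Lemma bailey_daum (a b q s : C) :
  (Cmod q < 1)%R -> b <> 0 -> (Cmod (q / b) < 1)%R ->
  qregular (a * q / b) q -> tends (Csum (bd_term a b q)) s ->
  s = qpoch_inf (a * q) (q ^ 2) * qpoch_inf (a * q ^ 2 / b ^ 2) (q ^ 2)
      * qpoch_inf (- q) q
      / (qpoch_inf (a * q / b) q * qpoch_inf (- (q / b)) q).
Proof.
intros Hq1 Hb Hqb Hd Hs. pose proof (qregular_small q q Hq1 Hq1) as Hq.
assert (Hz : (Cmod (- (q / b)) < 1)%R) by now rewrite Cmod_opp.
destruct (power_series_converges (fun n => qpoch b q n / qpoch q q n) (- (q / b)))
  as [s0 Hs0]; [apply bounded_mult; bdd | exact Hz |].
pose proof (qbinomial _ _ _ _ Hq1 Hz Hs0) as E0.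
replace (b * - (q / b)) with (- q) in E0 by (field; assumption).
destruct (bd_near_0 b q Hq1 Hb Hqb) as [K HK].
assert (Hq2 : (Cmod (q ^ 2) < 1)%R).
{ rewrite Cmod_pow. simpl. pose proof (Cmod_ge_0 q) as Hq0.
  assert (Cmod q * (Cmod q * 1) <= Cmod q * 1)%R by (apply Rmult_le_compat_l; lra). lra. }
assert (E : s * qpoch_inf (a * q / b) q
  = qpoch_inf (a * q) (q ^ 2) * qpoch_inf (a * q ^ 2 / b ^ 2) (q ^ 2) * s0).
{ destruct (eventually_small a (q ^ 2) ((1 - Cmod q) / 4) Hq2) as [m Hm]; [lra|].
  apply (iteration_limit (fun N => qpoch (a * q / b) q (2 * N))
    (fun N => qpoch (a * q) (q ^ 2) N * qpoch (a * q ^ 2 / b ^ 2) (q ^ 2) N) _ _ s s0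
    (K * Cmod a) (Cmod (q ^ 2)) m).
  - apply (tends_subseq (qpoch (a * q / b) q) _ (fun N => (2 * N)%nat)); [intros; lia|].
    now apply qpoch_tends.
  - apply tends_mult; now apply qpoch_tends.
  - split; [apply Cmod_ge_0 | exact Hq2].
  - intros N HN. destruct (bd_iteration a b q s N Hq1 Hb Hqb Hd Hs) as [t [Ht Et]].
    exists t. split; [exact Et|].
    replace (K * Cmod a * Cmod (q ^ 2) ^ N)%R with (K * Cmod (a * (q ^ 2) ^ N))%R
      by (rewrite Cmod_mult, (Cmod_pow (q ^ 2)); ring).
    apply HK; try assumption.
    + rewrite <- Cpow_mult_r.
      replace (a * q ^ (2 * N) * q / b) with (a * q / b * q ^ (2 * N)) by (field; assumption).
      now apply qregular_shift.
    + eapply Rle_trans; [|exact Hm]. rewrite !Cmod_mult, !(Cmod_pow (q ^ 2)).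
      apply Rmult_le_compat_l; [apply Cmod_ge_0|].
      replace N with (m + (N - m))%nat by lia. rewrite pow_add.
      rewrite <- (Rmult_1_r (Cmod (q ^ 2) ^ m)) at 2.
      apply Rmult_le_compat_l; [apply pow_le, Cmod_ge_0|].
      rewrite <- (pow1 (N - m)). apply pow_incr. split; [apply Cmod_ge_0 | lra]. }
pose proof (qpoch_inf_neq_0 _ _ Hq1 Hd) as D1.
pose proof (qpoch_inf_neq_0 _ _ Hq1 (qregular_small _ _ Hq1 Hz)) as D2.
rewrite <- E0.
set (I1 := qpoch_inf (a * q / b) q) in *. set (I2 := qpoch_inf (- (q / b)) q) in *.
transitivity (s * I1 / I1); [field; assumption|].
rewrite E. field. split; assumption.
Qed.

(** * Summation of the 4phi3 series *)

Lemma qpoch_inf_shift (x p : C) :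
  (Cmod p < 1)%R -> qpoch_inf x p = (1 - x) * qpoch_inf (x * p) p.
Proof.
intros Hp. apply (tends_unique (fun n => qpoch x p (S n))).
- apply (is_lim_seq_incr_1 (fun n => Cmod (qpoch x p n - qpoch_inf x p))).
  now apply qpoch_tends.
- apply tends_ext with (fun n => (1 - x) * qpoch (x * p) p n).
  + intros n. now rewrite qpoch_shift.
  + now apply tends_scal, qpoch_tends.
Qed.

Lemma qregular_of_neq_inv_pow (x q : C) :
  q <> 0 -> (forall k : nat, x <> / q ^ k) -> qregular x q.
Proof.
intros Hq H k Z. apply (H k).
pose proof (Cpow_nz q k Hq) as Hk.
replace x with (x * q ^ k / q ^ k) by (field; assumption).
replace (x * q ^ k) with (1 - (1 - x * q ^ k)) by ring. rewrite Z. field. assumption.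
Qed.

Theorem theorem6 (q a b : C)
  (hq0 : q <> 0) (hq1 : (Cmod q < 1)%R)
  (hb0 : b <> 0) (hqb : (Cmod (q / b) < 1)%R)
  (hab : a + b <> 0)
  (hd1 : forall k : nat, a * q / b <> / q ^ k)
  (hd2 : forall k : nat, (q + b) * a * q / (a + b) <> / q ^ k)
  (hd3 : forall k : nat, (1 + b) * a / (a + b) <> / q ^ k) :
  is_phi43
    a b ((q + b) * a / ((a + b) * q)) ((1 + b) * a * q / (a + b))
    (a * q / b) ((q + b) * a * q / (a + b)) ((1 + b) * a / (a + b))
    q (- (q / b))
    ((a + b - a * q - a * b) / b
     * (qpoch_inf (- q) q / (qpoch_inf (- (q / b)) q * qpoch_inf (a * q / b) q))
     * qpoch_inf (a * q ^ 2) (q ^ 2)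
     * qpoch_inf (a * q ^ 3 / b ^ 2) (q ^ 2)).
Proof.
apply tends_filterlim. change (sum_n ?u) with (Csum u).
assert (Hz : (Cmod (- (q / b)) < 1)%R) by now rewrite Cmod_opp.
pose proof (qregular_small q q hq1 hq1) as Hq.
pose proof (qregular_of_neq_inv_pow _ _ hq0 hd1) as Hd.
pose proof (qregular_of_neq_inv_pow _ _ hq0 hd2) as Hc.
pose proof (qregular_of_neq_inv_pow _ _ hq0 hd3) as Hdr.
set (c := (q + b) * a / (a + b)). set (d := (1 + b) * a / (a + b)) in *.
replace ((q + b) * a / ((a + b) * q)) with (c / q) by (unfold c; field; split; assumption).
replace ((1 + b) * a * q / (a + b)) with (d * q) by (unfold d; field; assumption).
replace ((q + b) * a * q / (a + b)) with (c * q) in * by (unfold c; field; assumption).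
assert (Hd' : qregular (a * q * q / b) q).
{ replace (a * q * q / b) with (a * q / b * q) by (field; assumption). now apply qregular_S. }
destruct (bd_summable (a * q) b q hq1 hqb Hd') as [s Hs].
pose proof (bailey_daum (a * q) b q s hq1 hb0 hqb Hd' Hs) as Es.
set (kappa := (a + b - a * q - a * b) / (b - a * q)).
pose proof (regular_cleared a b q 0 hb0 (Hd 0%nat)) as Hbq. simpl in Hbq. rewrite Cmult_1_r in Hbq.
replace ((a + b - a * q - a * b) / b
     * (qpoch_inf (- q) q / (qpoch_inf (- (q / b)) q * qpoch_inf (a * q / b) q))
     * qpoch_inf (a * q ^ 2) (q ^ 2)
     * qpoch_inf (a * q ^ 3 / b ^ 2) (q ^ 2)) with (0 + kappa * s).
- apply tends_ext with (fun n =>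
    (a / q * ((qpoch c q n * (qpoch (a * q) q n * qpoch b q (S n)))
      * (/ qpoch (c * q) q n * (/ qpoch q q n * / qpoch (a * q / b) q (S n)))))
     * (- (q / b)) ^ S n + kappa * Csum (bd_term (a * q) b q) n).
  + intros n.
    pose proof (phi43_telescope a b q n hq0 hb0 hab Hq Hd Hc Hdr) as E.
    rewrite (Csum_ext _ (fun k => 1 * phi43_term a b (c / q) (d * q) (a * q / b) (c * q) d q (- (q / b)) k
     - kappa * bd_term (a * q) b q k)) in E by (intros k; unfold kappa, c, d; ring).
    rewrite Csum_lin in E.
    set (T := Csum (phi43_term _ _ _ _ _ _ _ _ _) n) in *.
    replace T with (1 * T - kappa * Csum (bd_term (a * q) b q) n + kappa * Csum (bd_term (a * q) b q) n) by ring.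
    rewrite E. fold c. f_equal.
    pose proof (qregular_neq_0 _ _ n Hq) as H1. pose proof (qregular_neq_0 _ _ (S n) Hd) as H2.
    pose proof (qregular_neq_0 _ _ n Hc) as H3.
    set (D := qpoch (a * q / b) q (S n)) in *. set (Z := (- (q / b)) ^ S n).
    set (D' := qpoch (c * q) q n) in *.
    field. repeat split; assumption.
  + apply tends_plus; [apply tends_geom_0; [bdd | exact Hz] | now apply tends_scal].
(* Bailey-Daum at [aq] produces [(aq^2/b;q)] as denominator; its missing factor
   [1 - aq/b] turns the constant into the one with denominator [b]. *)
- rewrite Es, (qpoch_inf_shift (a * q / b)) by assumption.
  replace (a * q * q / b) with (a * q / b * q) by (field; assumption).
  replace (a * q * q ^ 2 / b ^ 2) with (a * q ^ 3 / b ^ 2) by (field; assumption).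
  replace (a * q * q) with (a * q ^ 2) by ring.
  pose proof (qpoch_inf_neq_0 _ _ hq1 (qregular_S _ _ Hd)) as D1.
  pose proof (qpoch_inf_neq_0 _ _ hq1 (qregular_small _ _ hq1 Hz)) as D2.
  set (I1 := qpoch_inf (a * q / b * q) q) in *. set (I2 := qpoch_inf (- (q / b)) q) in *.
  set (J := qpoch_inf (a * q ^ 3 / b ^ 2) (q ^ 2)).
  unfold kappa. field. repeat split; assumption.
Qed.
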